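(* Let $k$ be an algebraically closed field of characteristic $0$. The algebra $R=k\langle x,y\rangle/(xy-yx-y^2)$ is residually finite dimensional.
   Context: An algebra $R$ residually has a property $\mathcal{P}$ if there is a system of equivalence relations (congruences, i.e. modulo two-sided ideals) $\tau_i$ on $R$ with trivial intersection such that each quotient of $R$ by $\tau_i$ has property $\mathcal{P}$. Thus residually finite dimensional means that there is a family of two-sided ideals of $R$ with zero intersection and finite dimensional quotients. *)

(* Defs.v *)
From HB Require Import structures.
From mathcomp Require Import all_boot all_algebra boolp.
From mathcomp.multinomials Require Import monalg.

Set Implicit Arguments.
Unset Strict Implicit.
Unset Printing Implicit Defensive.

Import GRing.Theory.
Local Open Scope ring_scope.
Local Open Scope quotient_scope.

(* There is no closure condition for scalar multiplication: it follows from
   [c *: a = (c *: 1) * a]. *)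
Record two_sided_ideal (A : pzRingType) := TwoSidedIdeal {
  ideal_pred :> A -> Prop;
  ideal_zero : ideal_pred 0;
  ideal_sub : forall a b, ideal_pred a -> ideal_pred b -> ideal_pred (a - b);
  ideal_mull : forall a b, ideal_pred b -> ideal_pred (a * b);
  ideal_mulr : forall a b, ideal_pred a -> ideal_pred (a * b)
}.

Section GeneratedIdeal.
Variables (A : pzRingType) (S : A -> Prop).

Definition generated_pred (a : A) : Prop :=
  forall I : two_sided_ideal A, (forall s, S s -> I s) -> I a.

Definition generated_ideal : two_sided_ideal A.
Proof.
exists generated_pred.
- by move=> I _; apply: ideal_zero.
- by move=> a b Ia Ib I SI; apply: ideal_sub; [apply: Ia | apply: Ib].
- by move=> a b Ib I SI; apply: ideal_mull; apply: Ib.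
- by move=> a b Ia I SI; apply: ideal_mulr; apply: Ia.
Defined.

End GeneratedIdeal.

(* [I] may be the whole of [A], in which case the quotient is the zero ring.
   Since MathComp's [algType] excludes the zero ring, the quotient carries a
   [pzRingType] and an [lmodType] structure, made compatible by [qscaleAl] and
   [qscaleAr]. *)
Section Quotient.
Variables (K : pzRingType) (A : algType K) (I : two_sided_ideal A).

Definition ideal_equiv : rel A := fun a b => `[< I (a - b) >].

Lemma ideal_equiv_refl : reflexive ideal_equiv.
Proof. by move=> a; apply/asboolP; rewrite subrr; apply: ideal_zero. Qed.

Lemma ideal_opp a : I a -> I (- a).
Proof. by move=> Ia; rewrite -sub0r; apply: ideal_sub => //; apply: ideal_zero. Qed.

Lemma ideal_add a b : I a -> I b -> I (a + b).
Proof. by move=> Ia Ib; rewrite -[b]opprK; apply/ideal_sub/ideal_opp. Qed.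

Lemma ideal_scale c a : I a -> I (c *: a).
Proof. by move=> Ia; rewrite -[a]mul1r scalerAl; apply: ideal_mull. Qed.

Lemma ideal_equiv_sym : symmetric ideal_equiv.
Proof.
by move=> a b; apply/asboolP/asboolP => /ideal_opp; rewrite opprB.
Qed.

Lemma ideal_equiv_trans : transitive ideal_equiv.
Proof.
move=> b a c /asboolP Iab /asboolP Ibc; apply/asboolP.
by rewrite -(subrKA b); apply: ideal_add.
Qed.

Canonical ideal_equiv_rel :=
  EquivRel ideal_equiv ideal_equiv_refl ideal_equiv_sym ideal_equiv_trans.

Definition quotient_alg : Type := {eq_quot ideal_equiv_rel}.

HB.instance Definition _ := Choice.on quotient_alg.
HB.instance Definition _ := EqQuotient.on quotient_alg.

Definition qproj : A -> quotient_alg := \pi_quotient_alg.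

Lemma qproj_eqP a b : reflect (I (a - b)) (qproj a == qproj b).
Proof. by rewrite eqmodE; apply: asboolP. Qed.

Lemma qprojP a b : I (a - b) -> qproj a = qproj b.
Proof. by move=> Iab; apply/eqP/qproj_eqP. Qed.

Lemma qreprK (u : quotient_alg) : qproj (repr u) = u.
Proof. exact: reprK. Qed.

Lemma qprojK a : I (repr (qproj a) - a).
Proof. by apply/qproj_eqP; rewrite qreprK. Qed.

Definition qadd (u v : quotient_alg) := qproj (repr u + repr v).
Definition qopp (u : quotient_alg) := qproj (- repr u).
Definition qmul (u v : quotient_alg) := qproj (repr u * repr v).
Definition qscale (c : K) (u : quotient_alg) := qproj (c *: repr u).

Lemma qaddE a b : qadd (qproj a) (qproj b) = qproj (a + b).
Proof.
by apply: qprojP; rewrite opprD addrACA; apply: ideal_add; apply: qprojK.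
Qed.

Lemma qoppE a : qopp (qproj a) = qproj (- a).
Proof. by apply: qprojP; rewrite -opprD; apply/ideal_opp/qprojK. Qed.

Lemma qmulE a b : qmul (qproj a) (qproj b) = qproj (a * b).
Proof.
apply: qprojP; set a' := repr _; set b' := repr _.
rewrite -(subrKA (a * b')) -mulrBl -mulrBr.
by apply: ideal_add; [apply: ideal_mulr | apply: ideal_mull]; apply: qprojK.
Qed.

Lemma qscaleE c a : qscale c (qproj a) = qproj (c *: a).
Proof. by apply: qprojP; rewrite -scalerBr; apply/ideal_scale/qprojK. Qed.

Lemma qproj_ind (P : quotient_alg -> Prop) : (forall a, P (qproj a)) -> forall u, P u.
Proof. by move=> PH u; rewrite -[u]qreprK. Qed.

Lemma qaddA : associative qadd.
Proof.
by elim/qproj_ind=> a; elim/qproj_ind=> b; elim/qproj_ind=> c; rewrite !qaddE addrA.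
Qed.

Lemma qaddC : commutative qadd.
Proof. by elim/qproj_ind=> a; elim/qproj_ind=> b; rewrite !qaddE addrC. Qed.

Lemma qadd0 : left_id (qproj 0) qadd.
Proof. by elim/qproj_ind=> a; rewrite !qaddE add0r. Qed.

Lemma qaddN : left_inverse (qproj 0) qopp qadd.
Proof. by elim/qproj_ind=> a; rewrite qoppE qaddE addNr. Qed.

HB.instance Definition _ :=
  GRing.isZmodule.Build quotient_alg qaddA qaddC qadd0 qaddN.

Lemma qmulA : associative qmul.
Proof.
by elim/qproj_ind=> a; elim/qproj_ind=> b; elim/qproj_ind=> c; rewrite !qmulE mulrA.
Qed.

Lemma qmul1r : left_id (qproj 1) qmul.
Proof. by elim/qproj_ind=> a; rewrite !qmulE mul1r. Qed.

Lemma qmulr1 : right_id (qproj 1) qmul.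
Proof. by elim/qproj_ind=> a; rewrite !qmulE mulr1. Qed.

Lemma qmulDl : left_distributive qmul qadd.
Proof.
by elim/qproj_ind=> a; elim/qproj_ind=> b; elim/qproj_ind=> c;
   rewrite !(qmulE, qaddE) mulrDl.
Qed.

Lemma qmulDr : right_distributive qmul qadd.
Proof.
by elim/qproj_ind=> a; elim/qproj_ind=> b; elim/qproj_ind=> c;
   rewrite !(qmulE, qaddE) mulrDr.
Qed.

HB.instance Definition _ :=
  GRing.Zmodule_isPzRing.Build quotient_alg qmulA qmul1r qmulr1 qmulDl qmulDr.

Lemma qscaleA c d u : qscale c (qscale d u) = qscale (c * d) u.
Proof. by elim/qproj_ind: u => a; rewrite !qscaleE scalerA. Qed.

Lemma qscale1r : left_id 1 qscale.
Proof. by elim/qproj_ind=> a; rewrite qscaleE scale1r. Qed.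

Lemma qscaleDr : right_distributive qscale +%R.
Proof.
move=> c; elim/qproj_ind=> a; elim/qproj_ind=> b.
by rewrite -![_ + _]/(qadd _ _) !(qscaleE, qaddE) scalerDr.
Qed.

Lemma qscaleDl u : {morph qscale^~ u : c d / c + d}.
Proof.
elim/qproj_ind: u => a c d.
by rewrite -[RHS]/(qadd _ _) !(qscaleE, qaddE) scalerDl.
Qed.

HB.instance Definition _ :=
  GRing.Zmodule_isLmodule.Build K quotient_alg qscaleA qscale1r qscaleDr qscaleDl.

Lemma qscaleAl (c : K) (u v : quotient_alg) : c *: (u * v) = (c *: u) * v.
Proof.
elim/qproj_ind: u => a; elim/qproj_ind: v => b.
rewrite -[LHS]/(qscale _ (qmul _ _)) -[RHS]/(qmul (qscale _ _) _).
by rewrite !(qscaleE, qmulE) scalerAl.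
Qed.

Lemma qscaleAr (c : K) (u v : quotient_alg) : c *: (u * v) = u * (c *: v).
Proof.
elim/qproj_ind: u => a; elim/qproj_ind: v => b.
rewrite -[LHS]/(qscale _ (qmul _ _)) -[RHS]/(qmul _ (qscale _ _)).
by rewrite !(qscaleE, qmulE) scalerAr.
Qed.

End Quotient.

Definition finite_dimensional (K : fieldType) (V : lmodType K) : Prop :=
  exists n : nat, inhabited (Vector.axiom n V).

Definition residually_finite_dimensional (K : fieldType) (A : algType K) : Prop :=
  exists (T : Type) (I : T -> two_sided_ideal A),
    (forall a : A, (forall t, I t a) -> a = 0) /\
    (forall t, finite_dimensional (quotient_alg (I t))).

(* The free algebra k<x,y>, as the algebra of the free monoid on 'I_2. *)
Definition free_alg2 (k : fieldType) : Type := {malg k[{fmonom 'I_2}]}.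

HB.instance Definition _ (k : fieldType) := GRing.Lalgebra.on (free_alg2 k).

Section FreeAlg2.
Variable k : fieldType.

Lemma free_alg2_scaleAr (c : k) (a b : free_alg2 k) : c *: (a * b) = a * (c *: b).
Proof.
have centralC : a * c%:MP = c%:MP * a.
  rewrite -[LHS]/(fgmul a c%:MP) -[RHS]/(fgmul c%:MP a) fgmulUg fgmulgU.
  by apply: eq_bigr => m _; rewrite mulm1 mul1m mulrC.
rewrite -[c *: _]mul_malgC -[c *: b]mul_malgC.
by rewrite mulrA -[_ * a]centralC -mulrA.
Qed.

HB.instance Definition _ :=
  GRing.Lalgebra_isAlgebra.Build k (free_alg2 k) free_alg2_scaleAr.

Definition genX : free_alg2 k := << fmu (ord0 : 'I_2) >>.
Definition genY : free_alg2 k := << fmu (ord_max : 'I_2) >>.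

Definition relator : free_alg2 k := genX * genY - genY * genX - genY ^+ 2.

(* The algebra k<x,y>/(xy - yx - y^2), known as the Jordan plane. *)
Definition jordan_plane : Type := quotient_alg (generated_ideal (eq relator)).

HB.instance Definition _ := GRing.PzRing.on jordan_plane.
HB.instance Definition _ := GRing.Lmodule.on jordan_plane.

(* The kernel of the augmentation k<x,y> -> k, x, y |-> 0. *)
Definition augmentation_ideal : two_sided_ideal (free_alg2 k).
Proof.
exists (fun a : {malg k[{fmonom 'I_2}]} => a@_mone = 0).
- by rewrite mcoeff0.
- by move=> a b a0 b0; rewrite mcoeffB a0 b0 subrr.
- by move=> a b b0; rewrite rmorphM /= b0 mulr0.
- by move=> a b a0; rewrite rmorphM /= a0 mul0r.
Defined.

Lemma jordan_plane_nontrivial : (1 : jordan_plane) != 0.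
Proof.
apply/negP => /qproj_eqP; rewrite subr0 => /(_ augmentation_ideal) /= H.
have gen0 (i : 'I_2) : (<< fmu i >> : {malg k[{fmonom 'I_2}]})@_mone = 0.
  rewrite mcoeffU1; case: eqP => // /(congr1 (fun m => size (fmonom_val m))).
  by rewrite fmU fm1.
have: (1 : {malg k[{fmonom 'I_2}]})@_mone = 0.
  apply: H => _ <-; rewrite /relator /genX /genY !mcoeffB expr2.
  by rewrite !(rmorphM (mcoeff mone)) /= !gen0 !mul0r !subr0.
by move/eqP; rewrite mcoeff1 eqxx oner_eq0.
Qed.

HB.instance Definition _ :=
  GRing.PzSemiRing_isNonZero.Build jordan_plane jordan_plane_nontrivial.
HB.instance Definition _ :=
  GRing.Lmodule_isLalgebra.Build k jordan_plane
    (@qscaleAl _ _ (generated_ideal (eq relator))).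
HB.instance Definition _ :=
  GRing.Lalgebra_isAlgebra.Build k jordan_plane
    (@qscaleAr _ _ (generated_ideal (eq relator))).

End FreeAlg2.

(* Main.v *)
From HB Require Import structures.
Require Import Defs.
From mathcomp Require Import all_boot all_algebra boolp ring.
From mathcomp.multinomials Require Import monalg.

(** The Jordan plane has an explicit family of finite dimensional
    representations that separates its elements. For c in k, let it act on the
    right on k[t], with y acting as multiplication by t and x as c - t^2 d/dt;
    the relation xy - yx = y^2 is then the Leibniz rule
    (t f)' = f + t f' multiplied by t^2. Both operators preserve the ideals
    (t^n), so that they act on the finite dimensional quotients k[t]/(t^n).

    In the Jordan plane the relation lets one move every x to the left of every
    y, so that each element has the form u = sum_i p_i(x) y^i
    ([jordan_plane_normal_form]). The vector 1 is an eigenvector of x for the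
    eigenvalue c, hence 1.u = sum_i p_i(c) t^i ([row0_ordered_eval]). If u is
    killed by all these representations, then each p_i vanishes at every c in
    k, hence is zero because k is infinite; so u = 0. The required ideals are
    the kernels of the representations: their quotients embed in matrix
    algebras and are therefore finite dimensional. *)

Set Implicit Arguments.
Unset Strict Implicit.
Unset Printing Implicit Defensive.

Import GRing.Theory.
Local Open Scope ring_scope.

(** * Finite dimensionality by embedding *)

Lemma spanning_free_images (K : fieldType) (V : lmodType K) (W : vectType K)
    (f : V -> W) :
  exists2 s : seq V, free (map f s) & forall v, f v \in <<map f s>>%VS.
Proof.
(* A free family of images that does not span can be extended; d bounds the
   number of extensions still possible. *)
suff grow d (s : seq V) : free (map f s) -> (dim W - size s <= d)%N ->
    exists2 s : seq V, free (map f s) & forall v, f v \in <<map f s>>%VS.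
  by apply: (grow (dim W) [::]); rewrite ?nil_free ?leq_subr.
elim: d s => [|d IH] s free_s le_d.
  have/eqP full : <<map f s>>%VS == {:W}%VS.
    rewrite eqEdim subvf dimvf (eqP free_s) size_map /=.
    by rewrite -subn_eq0 -leqn0.
  by exists s => // v; rewrite full memvf.
case: (EM (forall v, f v \in <<map f s>>%VS)) => [span_s|].
  by exists s.
move=> /existsNP[v /negP v_out].
apply: (IH (v :: s)); first by rewrite /= free_cons v_out.
by rewrite /= subnS -subn1 leq_subLR add1n.
Qed.

(** The image of f need not be given as a subspace of W; preimages of a basis
    of it provide coordinates on V. *)
Lemma finite_dimensional_inj (K : fieldType) (V : lmodType K) (W : vectType K)
    (f : {linear V -> W}) : injective f -> finite_dimensional V.
Proof.
move=> f_inj; have [s free_s span_s] := spanning_free_images f.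
pose X := in_tuple (map f s).
have span_X v : f v \in <<X>>%VS := span_s v.
have free_X : free X := free_s.
exists (size (map f s)); constructor.
exists (fun v => \row_i coord X i (f v)).
  by move=> a u v; apply/rowP => i; rewrite !mxE !linearP.
exists (fun r : 'rV_(size (map f s)) => \sum_i r 0 i *: s`_i) => [v|r].
  apply: f_inj; rewrite linear_sum [RHS](coord_span (span_X v)).
  apply: eq_bigr => i _; rewrite linearZ mxE; congr (_ *: _).
  by rewrite (nth_map 0) // -(size_map f).
apply/rowP => i; rewrite mxE linear_sum /= -[RHS](coord_sum_free (r 0) i free_X).
congr (coord _ _ _); apply: eq_bigr => j _; rewrite linearZ /=.
by rewrite (nth_map 0) // -(size_map f).
Qed.

(** * Maps to and from quotient algebras *)

Section QuotientMaps.
Variables (K : pzRingType) (A : algType K) (I : two_sided_ideal A).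

Fact qproj_is_linear : linear (@qproj K A I).
Proof.
move=> c a b.
by rewrite -[RHS]/(qadd (qscale c (qproj I a)) (qproj I b)) qscaleE qaddE.
Qed.

Fact qproj_is_monoid_morphism : monoid_morphism (@qproj K A I).
Proof. by split=> // a b; rewrite -[RHS]/(qmul _ _) qmulE. Qed.

HB.instance Definition _ :=
  GRing.isLinear.Build K A (quotient_alg I) *:%R (@qproj K A I)
    qproj_is_linear.
HB.instance Definition _ :=
  GRing.isMonoidMorphism.Build A (quotient_alg I) (@qproj K A I)
    qproj_is_monoid_morphism.

Definition qlift (B : Type) (f : A -> B) (u : quotient_alg I) : B := f (repr u).

Lemma qlift_qproj (B : zmodType) (f : {additive A -> B})
    (f0 : forall a, I a -> f a = 0) a :
  qlift f (qproj I a) = f a.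
Proof. by apply/eqP; rewrite -subr_eq0 -raddfB; apply/eqP/f0/qprojK. Qed.

Lemma qlift_is_linear (B : lmodType K) (f : {linear A -> B})
    (f0 : forall a, I a -> f a = 0) :
  linear (qlift f).
Proof.
move=> c; elim/qproj_ind => a; elim/qproj_ind => b.
by rewrite -linearP !qlift_qproj //; exact: (linearP f).
Qed.

Lemma qlift_is_monoid_morphism (B : pzRingType) (f : {rmorphism A -> B})
    (f0 : forall a, I a -> f a = 0) :
  monoid_morphism (qlift f).
Proof.
split.
  by rewrite -(rmorph1 (qproj I)) qlift_qproj //; exact: (rmorph1 f).
elim/qproj_ind => a; elim/qproj_ind => b.
by rewrite -rmorphM !qlift_qproj //; exact: (rmorphM f).
Qed.

End QuotientMaps.

Definition kernel_ideal (A B : pzRingType) (f : {rmorphism A -> B}) :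
  two_sided_ideal A.
Proof.
exists (fun a => f a = 0).
- exact: rmorph0.
- by move=> a b fa fb; rewrite rmorphB fa fb subr0.
- by move=> a b fb; rewrite rmorphM fb mulr0.
- by move=> a b fa; rewrite rmorphM fa mul0r.
Defined.

Lemma finite_dimensional_quotient_kernel (K : fieldType) (A : algType K)
    (n : nat) (f : {lrmorphism A -> 'M[K]_n.+1}) :
  finite_dimensional (quotient_alg (kernel_ideal f)).
Proof.
have f0 a : kernel_ideal f a -> f a = 0 by [].
pose g : {linear _ -> _} :=
  HB.pack (qlift f) (GRing.isLinear.Build _ _ _ _ _ (qlift_is_linear f0)).
apply: (@finite_dimensional_inj _ _ _ g).
elim/qproj_ind => a; elim/qproj_ind => b.
rewrite /g /= !qlift_qproj // => fab.
by apply: qprojP; rewrite /= linearB fab subrr.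
Qed.

(** * Ordered polynomials in two noncommuting elements *)

Definition jordan_relator (A : pzRingType) (x y : A) : A :=
  x * y - y * x - y ^+ 2.

Lemma rmorph_jordan_relator (A B : pzRingType) (f : {rmorphism A -> B}) x y :
  f (jordan_relator x y) = jordan_relator (f x) (f y).
Proof. by rewrite /jordan_relator !rmorphB rmorphXn !rmorphM. Qed.

(** The outer variable of P stands for y and the inner one for x; as
    evaluation puts coefficients on the left, the value is
    sum_i p_i(x) y^i, where p_i is the coefficient of index i of P. *)
Definition ordered_eval (k : fieldType) (A : algType k) (x y : A)
    (P : {poly {poly k}}) : A :=
  (map_poly (horner_alg x) P).[y].

(** Right multiplication by x, read on ordered polynomials: since
    y^i x = x y^i - i y^(i+1), it multiplies the coefficients by x and
    subtracts y^2 d/dy. *)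
Definition mulrx (k : fieldType) (P : {poly {poly k}}) : {poly {poly k}} :=
  'X *: P - P^`() * 'X^2.

Lemma mulrxMXaddC (k : fieldType) (P : {poly {poly k}}) p :
  mulrx (P * 'X + p%:P) = mulrx P * 'X - P * 'X * 'X + (p * 'X)%:P.
Proof.
by rewrite /mulrx derivD derivC derivM derivX -!mul_polyC polyCM; ring.
Qed.

Section OrderedEval.
Variables (k : fieldType) (A : algType k) (x y : A).
Implicit Types P Q : {poly {poly k}}.

Lemma ordered_evalD P Q :
  ordered_eval x y (P + Q) = ordered_eval x y P + ordered_eval x y Q.
Proof. by rewrite /ordered_eval rmorphD hornerD. Qed.

Lemma ordered_evalN P : ordered_eval x y (- P) = - ordered_eval x y P.
Proof. by rewrite /ordered_eval rmorphN hornerN. Qed.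

Lemma ordered_evalC p : ordered_eval x y p%:P = horner_alg x p.
Proof. by rewrite /ordered_eval map_polyC hornerC. Qed.

Lemma ordered_eval0 : ordered_eval x y 0 = 0.
Proof. by rewrite -[0]polyC0 ordered_evalC rmorph0. Qed.

Lemma ordered_evalZ c P :
  ordered_eval x y (c%:P *: P) = c *: ordered_eval x y P.
Proof.
by rewrite /ordered_eval map_polyZ hornerZ /= horner_algC -scalerAl mul1r.
Qed.

Lemma ordered_evalMX P : ordered_eval x y (P * 'X) = ordered_eval x y P * y.
Proof. by rewrite /ordered_eval rmorphM /= map_polyX hornerMX. Qed.

Lemma ordered_eval_mulrx P : jordan_relator x y = 0 ->
  ordered_eval x y (mulrx P) = ordered_eval x y P * x.
Proof.
move=> /eqP; rewrite subr_eq0 subr_eq => /eqP xy.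
have {xy}yx : y * x = x * y - y * y by rewrite xy expr2 addrAC subrr add0r.
elim/poly_ind: P => [|P p IH].
  by rewrite /mulrx deriv0 mul0r subr0 scaler0 ordered_eval0 mul0r.
rewrite mulrxMXaddC; move: (mulrx P) IH => Q IH.
rewrite !(ordered_evalD, ordered_evalN, ordered_evalMX, ordered_evalC).
by rewrite IH rmorphM /= horner_algX mulrDl -!mulrA yx mulrBr.
Qed.

End OrderedEval.

Lemma rmorph_horner_alg (k : fieldType) (A B : algType k)
    (f : {lrmorphism A -> B}) x p :
  f (horner_alg x p) = horner_alg (f x) p.
Proof.
elim/poly_ind: p => [|p c IH]; first by rewrite !rmorph0.
rewrite !(rmorphD, rmorphM) /= !horner_algX !horner_algC IH.
by rewrite linearZ rmorph1.
Qed.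

Lemma rmorph_ordered_eval (k : fieldType) (A B : algType k)
    (f : {lrmorphism A -> B}) x y P :
  f (ordered_eval x y P) = ordered_eval (f x) (f y) P.
Proof.
elim/poly_ind: P => [|P p IH]; first by rewrite !ordered_eval0 rmorph0.
rewrite !(ordered_evalD, ordered_evalMX, ordered_evalC) rmorphD rmorphM /= IH.
by congr (_ + _); exact: rmorph_horner_alg.
Qed.

(** * The representation on truncated polynomials *)

Section TruncatedPolynomials.
Variables (k : fieldType) (n : nat).

(** Matrices act on row vectors from the right, and the i-th unit row stands
    for t^i in k[t]/(t^(n+1)). Thus [shift_mx] is multiplication by t,
    [degree_mx] is t d/dt, and [jordan_x_mx c] is c - t^2 d/dt. *)
Definition shift_mx : 'M[k]_n.+1 := \matrix_(i, j) (j == i.+1 :> nat)%:R.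
Definition degree_mx : 'M[k]_n.+1 := diag_mx (\row_i i%:R).
Definition jordan_x_mx (c : k) : 'M[k]_n.+1 := c%:M - degree_mx * shift_mx.

Lemma degree_shift_mx :
  shift_mx * degree_mx = degree_mx * shift_mx + shift_mx.
Proof.
apply/matrixP => i j; rewrite -!mulmxE mul_mx_diag mul_diag_mx !mxE.
case: eqP => [->|_]; last by rewrite mul0r mulr0 addr0.
by rewrite mul1r mulr1 -natr1.
Qed.

Lemma jordan_relator_mx c : jordan_relator (jordan_x_mx c) shift_mx = 0.
Proof.
have comm : c%:M * shift_mx = shift_mx * c%:M by rewrite -!mulmxE scalar_mxC.
rewrite /jordan_relator /jordan_x_mx mulrBl mulrBr !mulrA degree_shift_mx.
rewrite mulrDl -expr2 comm opprB -(addrA (degree_mx * _ * _)) subrKA.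
by rewrite [X in X - _]addrC subrK subrr.
Qed.

(** Row 0 of a matrix is its action on the vector 1. As t d/dt kills 1, this
    vector is an eigenvector of x for the eigenvalue c, so that p(x) y^i sends
    it to p(c) t^i. *)
Lemma row0_ordered_eval c (P : {poly {poly k}}) (j : 'I_n.+1) :
  ordered_eval (jordan_x_mx c) shift_mx P ord0 j = (P`_j).[c].
Proof.
have row0_x (p : {poly k}) :
    delta_mx 0 0 *m horner_alg (jordan_x_mx c) p
      = p.[c] *: (delta_mx 0 0 : 'rV[k]_n.+1).
  elim/poly_ind: p => [|p d IH].
    by rewrite rmorph0 mulmx0 horner0 scale0r.
  rewrite rmorphD rmorphM /= horner_algX horner_algC hornerMXaddC.
  rewrite mulmxDr mulmxA IH -!scalemxAl -scalemxAr mulmx1 scalerDl -scalerA.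
  congr (_ *: _ + _).
  rewrite /jordan_x_mx mulmxBr mul_mx_scalar -mulmxE mulmxA.
  suff -> : delta_mx 0 0 *m degree_mx = 0 :> 'rV[k]_n.+1.
    by rewrite mul0mx subr0.
  apply/rowP => i; rewrite mul_mx_diag !mxE eqxx /=.
  by case: (i =P 0) => [->|_]; rewrite ?mulr0 ?mul0r.
elim/poly_ind: P j => [|P p IH] j.
  by rewrite ordered_eval0 coefC if_same horner0 mxE.
rewrite ordered_evalD ordered_evalMX ordered_evalC coefD coefMX coefC.
rewrite hornerD mxE; congr (_ + _).
- rewrite -mulmxE mxE; case: j => [[|j] lt_j] /=.
    by rewrite horner0 big1 // => i _; rewrite !mxE mulr0.
  rewrite (bigD1 (Ordinal (ltnW lt_j))) //= IH mxE eqxx mulr1.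
  rewrite big1 ?addr0 // => i.
  by rewrite -val_eqE mxE eqSS eq_sym => /negPf->; rewrite mulr0.
- have /rowP/(_ j) := row0_x p; rewrite -rowE !mxE => ->.
  by rewrite eqxx -val_eqE /=; case: eqP; rewrite ?mulr1 ?mulr0 ?horner0.
Qed.

End TruncatedPolynomials.

(** * The free algebra on two generators *)

Section FreeEval.
Variables (k : fieldType) (B : algType k) (b : 'I_2 -> B).

Definition word_eval (m : {fmonom 'I_2}) : B := \prod_(i <- m) b i.

Fact word_eval_mmorphism : mmorphism word_eval.
Proof.
by split=> [m m'|]; rewrite /word_eval ?fm1 ?big_nil // fmM big_cat.
Qed.

HB.instance Definition _ :=
  isMultiplicative.Build {fmonom 'I_2} B word_eval word_eval_mmorphism.

Definition free_eval : free_alg2 k -> B := mmap (in_alg B) word_eval.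

Fact free_eval_is_linear : linear free_eval.
Proof.
by move=> c g h; rewrite /free_eval mmapD mmapZ /= -scalerAl mul1r.
Qed.

Fact free_eval_is_monoid_morphism : monoid_morphism free_eval.
Proof.
have [] := @commr_mmap_is_multiplicative _ _ _ (in_alg B) word_eval.
  by move=> g m m'; exact: comm_alg.
by split.
Qed.

HB.instance Definition _ :=
  GRing.isLinear.Build k (free_alg2 k) B *:%R free_eval free_eval_is_linear.
HB.instance Definition _ :=
  GRing.isMonoidMorphism.Build (free_alg2 k) B free_eval
    free_eval_is_monoid_morphism.

Lemma free_eval_gen i : free_eval << fmu i >> = b i.
Proof. by rewrite /free_eval mmapU /= scale1r mul1r /word_eval fmU big_seq1. Qed.

End FreeEval.

(** Words grow on the right, to match the closure properties of ordered
    polynomials. *)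
Lemma free_alg2_ind (k : fieldType) (S : free_alg2 k -> Prop) :
  (forall c a b, S a -> S b -> S (c *: a + b)) -> S 0 -> S 1 ->
  (forall a, S a -> S (a * genX k)) -> (forall a, S a -> S (a * genY k)) ->
  forall a, S a.
Proof.
move=> SL S0 S1 SX SY a.
have Sw (w : seq 'I_2) : S << FMonom w >>.
  elim/last_ind: w => [|w i IH]; first by rewrite -fmoneE.
  have -> : << FMonom (rcons w i) >> = << FMonom w >> * << fmu i >>
      :> free_alg2 k.
    rewrite -[RHS]/(fgmul _ _) fgmulUU mulr1; congr << _ >>.
    by apply/eqP; rewrite fmP fmM fmU cats1.
  have : i \in [:: ord0; ord_max] by case: i => [[|[|]]].
  by rewrite !inE => /orP[] /eqP ->; [apply: SX | apply: SY].
rewrite [a]monalgE; elim/big_ind: _ => // [u v Su Sv|[w] _].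
  by rewrite -[u]scale1r; apply: SL.
suff -> : << a@_(FMonom w) *g FMonom w >>
    = a@_(FMonom w) *: << FMonom w >> + 0 :> free_alg2 k by exact: SL.
by rewrite addr0; apply/malgP => m; rewrite mcoeffZ !mcoeffU mulr_natr.
Qed.

Lemma relatorE (k : fieldType) : relator k = jordan_relator (genX k) (genY k).
Proof. by []. Qed.

(** The ordered polynomials in the images of the generators contain 1 and are
    stable under linear combinations and under right multiplication by both
    generators: by y trivially, by x thanks to the relation. *)
Lemma free_image_normal_form (k : fieldType) (A : algType k)
    (f : {lrmorphism free_alg2 k -> A}) (a : free_alg2 k) :
  f (relator k) = 0 ->
  exists P, f a = ordered_eval (f (genX k)) (f (genY k)) P.
Proof.
rewrite relatorE rmorph_jordan_relator => xy.
have fL c a' b : f (c *: a' + b) = c *: f a' + f b := linearP f c a' b.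
have fM a' b : f (a' * b) = f a' * f b := rmorphM f a' b.
elim/free_alg2_ind: a => [c a b [P aP] [Q bQ]|||a [P aP]|a [P aP]].
- by exists (c%:P *: P + Q); rewrite fL ordered_evalD ordered_evalZ aP bQ.
- by exists 0%:P; rewrite ordered_evalC !rmorph0.
- by exists 1%:P; rewrite ordered_evalC !rmorph1.
- by exists (mulrx P); rewrite fM aP ordered_eval_mulrx.
- by exists (P * 'X); rewrite fM aP ordered_evalMX.
Qed.

(** * The Jordan plane *)

Section JordanPlane.
Variable k : fieldType.

Definition jordan_proj : free_alg2 k -> jordan_plane k :=
  @qproj _ _ (generated_ideal (eq (relator k))).

HB.instance Definition _ :=
  GRing.isLinear.Build k (free_alg2 k) (jordan_plane k) *:%R jordan_proj
    (@qproj_is_linear _ _ _).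
HB.instance Definition _ :=
  GRing.isMonoidMorphism.Build (free_alg2 k) (jordan_plane k) jordan_proj
    (@qproj_is_monoid_morphism _ _ _).

Lemma jordan_proj_relator : jordan_proj (relator k) = 0.
Proof.
rewrite -(rmorph0 jordan_proj).
by apply: qprojP; rewrite subr0 => I /(_ _ erefl).
Qed.

Lemma jordan_plane_normal_form (u : jordan_plane k) :
  exists P, u = ordered_eval (jordan_proj (genX k)) (jordan_proj (genY k)) P.
Proof.
elim/qproj_ind: u => a.
apply: (free_image_normal_form (f := jordan_proj) a).
exact: jordan_proj_relator.
Qed.

Section UniversalProperty.
Variables (B : algType k) (b : 'I_2 -> B).
Hypothesis b_relator : jordan_relator (b ord0) (b ord_max) = 0.

Fact free_eval_relator_ideal a :
  generated_ideal (eq (relator k)) a -> free_eval b a = 0.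
Proof.
move=> Ja; apply: (Ja (kernel_ideal (free_eval b))) => _ <-.
by rewrite /= relatorE rmorph_jordan_relator /= !free_eval_gen.
Qed.

Definition jordan_eval : jordan_plane k -> B := qlift (free_eval b).

Fact jordan_eval_is_linear : linear jordan_eval.
Proof. exact: qlift_is_linear free_eval_relator_ideal. Qed.

Fact jordan_eval_is_monoid_morphism : monoid_morphism jordan_eval.
Proof. exact: qlift_is_monoid_morphism free_eval_relator_ideal. Qed.

Definition jordan_morphism : {lrmorphism jordan_plane k -> B} :=
  HB.pack jordan_eval
    (GRing.isLinear.Build k (jordan_plane k) B *:%R _ jordan_eval_is_linear)
    (GRing.isMonoidMorphism.Build (jordan_plane k) B _
       jordan_eval_is_monoid_morphism).

Lemma jordan_morphism_gen i : jordan_morphism (jordan_proj << fmu i >>) = b i.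
Proof.
rewrite -[LHS]/(qlift _ (qproj _ _)) qlift_qproj.
  exact: free_eval_gen.
exact: free_eval_relator_ideal.
Qed.

End UniversalProperty.

Definition jordan_rep (n : nat) (c : k) :
    {lrmorphism jordan_plane k -> 'M[k]_n.+1} :=
  @jordan_morphism _ (fun i => if i == ord0 then jordan_x_mx n c else shift_mx k n)
    (jordan_relator_mx n c).

Lemma row0_jordan_rep n c P (j : 'I_n.+1) :
  jordan_rep n c (ordered_eval (jordan_proj (genX k)) (jordan_proj (genY k)) P)
    ord0 j = (P`_j).[c].
Proof.
by rewrite rmorph_ordered_eval !jordan_morphism_gen row0_ordered_eval.
Qed.

End JordanPlane.

Theorem corollary5p4 (k : closedFieldType) (char_k : [pchar k]%R =i pred0) :
  residually_finite_dimensional (jordan_plane k).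
Proof.
exists (nat * k)%type, (fun nc => kernel_ideal (jordan_rep nc.1 nc.2)).
split=> [u u0|nc]; last exact: finite_dimensional_quotient_kernel.
have [P uP] := jordan_plane_normal_form u.
suff P0 : P = 0 by rewrite uP P0 ordered_eval0.
apply/polyP => j; rewrite coef0; apply/eqP/negP => /negP.
(* At a point c where the j-th coefficient does not vanish, truncating after
   t^j keeps that coefficient as the last entry of row 0. *)
move=> /closed_nonrootP[c /negP[]].
have /matrixP/(_ ord0 ord_max) := u0 (j, c).
by rewrite uP row0_jordan_rep mxE => /eqP.
Qed.
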